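(* Let $\Omega$ be a finite state space with at least two elements, and let $Q_{initial}$ and $Q_{final}$ be generators of continuous-time Markov processes on $\Omega$ with off-diagonal rates $q_{i,j}^{initial}$ and $q_{i,j}^{final}$ ($i\ne j$), such that $Q_{final}$ has a unique stationary distribution $\pi_f$. For all pairs $i\neq j$ in $\Omega$ let $\phi_{i,j}:[0,1]\to[0,1]$ be continuous with $\phi_{i,j}(0)=0$ and $\phi_{i,j}(1)=1$, and for $s\in[0,1]$ let $Q[s]$ be the Markov generator with off-diagonal entries $$q_{i,j}[s]=(1-\phi_{i,j}(s))\,q_{i,j}^{initial}+\phi_{i,j}(s)\,q_{i,j}^{final},\qquad i\neq j.$$ For $T>0$, let $Q\left[\frac tT\right]$ $(t\in[0,T])$ generate the time-inhomogeneous continuous-time Markov chain on $[0,T]$. Let $\phi(s)=\min_{i\ne j}\phi_{i,j}(s)$ be the pointwise minimum of all the functions $\phi_{i,j}$. Suppose $m\ge1$ is an integer such that $\phi$ is $m+1$ times continuously differentiable in a neighborhood of $1$ (in $[0,1]$), $\phi^{(k)}(1)=0$ for all integers $k$ with $1\le k<m$, and $\phi^{(m)}(1)\ne0$. Let $\lambda$ be such that $$\lambda\ge\max_{i\in\Omega}\sum_{j:j\ne i}q_{i,j}^{initial}\quad\text{and}\quad\lambda\ge\max_{i\in\Omega}\sum_{j:j\neq i}q_{i,j}^{final}.$$ Then the adiabatic time $T_\epsilon$ satisfies $$T_\epsilon=\mathcal{O}\left(\left[\frac{\lambda}{\epsilon}\right]^{\frac1m}t_{mix}(\epsilon/2)^{\frac{m+1}{m}}\right),$$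 where $t_{mix}$ is the mixing time of $Q_{final}$. Here the $\mathcal{O}$ means: there exist constants $C>0$ and $\epsilon_0\in(0,1)$, depending only on the function $\phi$ (and hence $m$) and not on $\Omega$, $Q_{initial}$, $Q_{final}$, $\lambda$, such that for all $0<\epsilon\le\epsilon_0$, $T_\epsilon\le C\,(\lambda/\epsilon)^{\frac1m}\,t_{mix}(\epsilon/2)^{\frac{m+1}{m}}$.
   Context: Probability distributions on $\Omega$ are row vectors, and $\|\cdot\|_{TV}$ is the total variation distance. A generator on $\Omega$ is a real matrix with nonnegative off-diagonal entries and zero row sums; a stationary distribution of $Q$ is a probability distribution $\pi$ with $\pi e^{tQ}=\pi$ for all $t\geq 0$. Mixing time: for $\epsilon>0$, the mixing time of $Q_{final}$ is $t_{mix}(\epsilon)=\inf\{t\ge0:\|\nu e^{tQ_{final}}-\pi_f\|_{TV}\le\epsilon\text{ for all probability distributions }\nu\text{ on }\Omega\}$. For $T>0$ and $0\le t_1\le t_2\le T$, $P_T(t_1,t_2)$ denotes the matrix of transition probabilities, over the time interval $[t_1,t_2]$, of the time-inhomogeneous Markov process with generator $Q\left[\frac tT\right]$ at time $t$; that is, $P_T(t_1,t_1)=I$ and $\frac{\partial}{\partial t}P_T(t_1,t)=P_T(t_1,t)\,Q\left[\frac tT\right]$. Adiabatic time: for $\epsilon>0$, $T_\epsilon$ is the least (infimum) $T>0$ such that $\max_\nu\|\nu P_T(0,T)-\pi_f\|_{TV}\le\epsilon$, the maximum being over all probability distributions $\nu$ on $\Omega$. *)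

(* Defs.v *)
From mathcomp Require Import all_boot all_order all_algebra.
From mathcomp Require Import all_classical all_reals all_analysis.

Set Implicit Arguments.
Unset Strict Implicit.
Unset Printing Implicit Defensive.

Import Order.TTheory GRing.Theory Num.Theory.
Import numFieldNormedType.Exports.

Local Open Scope classical_set_scope.
Local Open Scope ring_scope.

Section derivative_relative_to_a_set.
Variable R : realType.
Implicit Types (A : set R) (f : R -> R) (x l : R).

(* Difference quotients are taken along points of A only, so that derivatives
   at the end points of an interval A are one-sided. *)
Definition is_derive_in A f x l : Prop :=
  (f y - f x) / (y - x) @[y --> within A x^'] --> l.

Definition derivable_in A f x : Prop := exists l, is_derive_in A f x l.

(* Unspecified where f is not derivable relative to A. *)
Definition derive_in A f x : R :=
  lim ((f y - f x) / (y - x) @[y --> within A x^']).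

Definition derive_inn A (k : nat) f : R -> R := iter k (derive_in A) f.

Definition Ck_in_near A (k : nat) f (a : R) : Prop :=
  \forall x \near a, A x ->
    (forall j, (j < k)%N -> derivable_in A (derive_inn A j f) x) /\
    derive_inn A k f y @[y --> within A (nbhs x)] --> derive_inn A k f x.

End derivative_relative_to_a_set.

(* The state space is 'I_n. *)
Section markov.
Variables (R : realType) (n : nat).
Implicit Types (A Q : 'M[R]_n) (mu nu pi : 'rV[R]_n).

Definition is_distr mu : Prop :=
  (forall i, 0 <= mu 0 i) /\ \sum_i mu 0 i = 1.

Definition tv_dist mu nu : R := 2^-1 * \sum_i `|mu 0 i - nu 0 i|.

Definition is_generator Q : Prop :=
  (forall i j, i != j -> 0 <= Q i j) /\ (forall i, \sum_j Q i j = 0).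

Definition exp_mx A : 'M[R]_n :=
  \matrix_(i, j) limn (series (fun k => (A ^+ k) i j / k`!%:R)).

Definition is_stationary Q pi : Prop :=
  is_distr pi /\ forall t, 0 <= t -> pi *m exp_mx (t *: Q) = pi.

Definition is_unique_stationary Q pi : Prop :=
  is_stationary Q pi /\ forall pi', is_stationary Q pi' -> pi' = pi.

(* An infimum in \bar R: it is +oo when no time is admissible. *)
Definition t_mix Q pi (eps : R) : \bar R :=
  ereal_inf [set t%:E | t in [set t : R | 0 <= t /\
    forall nu, is_distr nu -> tv_dist (nu *m exp_mx (t *: Q)) pi <= eps]].

Definition interp_gen (phi : 'I_n -> 'I_n -> R -> R) (Qi Qf : 'M[R]_n)
    (s : R) : 'M[R]_n :=
  let q i j := (1 - phi i j s) * Qi i j + phi i j s * Qf i j in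
  \matrix_(i, j) (if i == j then - \sum_(k | k != i) q i k else q i j).

(* P t1 t2 is the transition matrix over [t1, t2] of the chain with generator
   G t at time t, 0 <= t <= T. *)
Definition is_transition (T : R) (G : R -> 'M[R]_n)
    (P : R -> R -> 'M[R]_n) : Prop :=
  forall t1, 0 <= t1 <= T ->
    P t1 t1 = 1%:M /\
    forall t, t1 <= t <= T -> forall i j,
      is_derive_in `[t1, T] (fun u => P t1 u i j) t ((P t1 t *m G t) i j).

(* P T is the family of transition matrices of the chain run on [0, T].
   Again +oo when no T is admissible. *)
Definition adiabatic_time (P : R -> R -> R -> 'M[R]_n) pi (eps : R) : \bar R :=
  ereal_inf [set T%:E | T in [set T : R | 0 < T /\
    forall nu, is_distr nu -> tv_dist (nu *m P T 0 T) pi <= eps]].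

(* The neutral element 1 is harmless: the phi i j take values in [0, 1]. *)
Definition min_offdiag (phi : 'I_n -> 'I_n -> R -> R) (s : R) : R :=
  \big[Num.min/1]_(p : 'I_n * 'I_n | p.1 != p.2) phi p.1 p.2 s.

End markov.

(* Main.v *)
(* Work in the l1 norm, i.e. twice the total variation distance.  A solution of
   u' = u Q(t) + r(t) with generators Q(t) has an l1 norm growing at most at the
   rate |r(t)|, because u |-> u (1 + h Q) is an l1 contraction for small h >= 0.
   Applied to nu P_T(0, t) - q exp ((t - T + K) Q_final), with K a mixing time
   for eps / 2 and q the law at time T - K, this bounds the error made by
   replacing Q[t / T] by Q_final during the last K units of time by
   4 lam K sup (1 - phi) over [1 - K / T, 1], where 1 - phi (s) = O((1 - s)^m);
   solving for T gives the theorem.  Applied to nu exp (t Q) - nu, it shows that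
   mixing takes a time at least 1 / (4 lam): this makes T >= K, and makes
   t_mix positive, so that some mixing time K < 2 t_mix exists. *)
Require Import Defs.
From mathcomp Require Import all_boot all_order all_algebra.
From mathcomp Require Import all_classical all_reals all_analysis.
From mathcomp Require Import ring lra zify.
Import Order.TTheory GRing.Theory Num.Theory.
Import numFieldNormedType.Exports.
Local Open Scope classical_set_scope.
Local Open Scope ring_scope.

Set Implicit Arguments.
Unset Strict Implicit.
Unset Printing Implicit Defensive.

(** * Derivatives relative to a set and Dini-type inequalities *)

Section derivatives_relative_to_a_set.
Variable R : realType.
Implicit Types (A B : set R) (f g w d : R -> R) (a b c x l : R).

Lemma is_derive_in_bound A f x l : is_derive_in A f x l ->
  forall e, 0 < e ->
  \forall y \near within A (nbhs x), `|f y - f x - l * (y - x)| <= e * `|y - x|.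
Proof.
move=> /cvgrPdist_le fl e e0; have /nbhs_ballP[d /= d0 dA] := fl _ e0.
apply/nbhs_ballP; exists d => //= y yd Ay.
have [->|yx] := eqVneq y x; first by rewrite !subrr mulr0 subrr !normr0 mulr0.
have /= := dA y yd yx Ay; have yx0 : y - x != 0 by rewrite subr_eq0.
rewrite distrC -(ler_pM2r (x := `|y - x|)) ?normr_gt0// -normrM mulrBl.
by rewrite mulfVK.
Qed.

Lemma is_derive_in_subset A B f x l :
  A `<=` B -> is_derive_in B f x l -> is_derive_in A f x l.
Proof.
move=> AB fl S /fl; rewrite /= /nbhs /=; exact: within_subset.
Qed.

Lemma is_derive_in_continuous A f x l : is_derive_in A f x l ->
  f y @[y --> within A (nbhs x)] --> f x.
Proof.
move=> fl; apply/cvgrPdist_le => e e0.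
have := is_derive_in_bound fl ltr01.
have k0 : 0 < `|l| + 1 by have := normr_ge0 l; lra.
apply: filterS2 (_ : \forall y \near within A (nbhs x), `|y - x| <= e / (`|l| + 1)).
  move=> y; rewrite ler_pdivlMr// => yx fyx.
  have := ler_normD (f y - f x - l * (y - x)) (l * (y - x)).
  rewrite subrK normrM distrC; lra.
apply/nbhs_ballP; exists (e / (`|l| + 1)); first by rewrite /= divr_gt0.
by move=> y; rewrite /= -ball_normE /= distrC => /ltW.
Qed.

Lemma is_derive_is_derive_in A f x l : is_derive x 1 f l -> is_derive_in A f x l.
Proof.
move=> [fx <-]; move: fx; rewrite /derivable => /cvgrPdist_le fx.
apply/cvgrPdist_le => e /fx /nbhs_ballP[d /= d0 dA].
apply/nbhs_ballP; exists d => //= y yd yx Ay.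
have := dA (y - x); rewrite /= -ball_normE /= sub0r normrN subr_eq0 distrC => /(_ yd yx).
by rewrite /= /GRing.scale /= mulr1 subrK mulrC.
Qed.

Lemma is_derive_in_ext A f g x l l' :
  f =1 g -> l = l' -> is_derive_in A f x l -> is_derive_in A g x l'.
Proof. by move=> /funext -> ->. Qed.

Lemma is_derive_in_cst A x l : is_derive_in A (fun=> l) x 0.
Proof.
rewrite /is_derive_in (_ : (fun _ => _) = fun=> 0); first exact: cvg_cst.
by apply/funext => y; rewrite subrr mul0r.
Qed.

Lemma is_derive_inD A f g x l l' : is_derive_in A f x l ->
  is_derive_in A g x l' -> is_derive_in A (fun y => f y + g y) x (l + l').
Proof.
move=> fl gl; have E y : (f y - f x) / (y - x) + (g y - g x) / (y - x) =
  (f y + g y - (f x + g x)) / (y - x) by rewrite -mulrDl; congr (_ / _); ring.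
by rewrite /is_derive_in -(eq_cvg _ _ E); exact: cvgD.
Qed.

Lemma is_derive_inMl A f x l c : is_derive_in A f x l ->
  is_derive_in A (fun y => c * f y) x (c * l).
Proof.
move=> fl; have E y : c * ((f y - f x) / (y - x)) = (c * f y - c * f x) / (y - x).
  by rewrite -mulrBr mulrA.
by rewrite /is_derive_in -(eq_cvg _ _ E); exact: cvgMl_tmp.
Qed.

Lemma is_derive_inB A f g x l l' : is_derive_in A f x l ->
  is_derive_in A g x l' -> is_derive_in A (fun y => f y - g y) x (l - l').
Proof.
move=> fl gl; have := is_derive_inD fl (is_derive_inMl (c := -1) gl).
by apply: is_derive_in_ext => [y|]; rewrite mulN1r.
Qed.

Lemma is_derive_in_sum A x (I : finType) (F : I -> R -> R) (l : I -> R) :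
  (forall i, is_derive_in A (F i) x (l i)) ->
  is_derive_in A (fun y => \sum_i F i y) x (\sum_i l i).
Proof.
move=> Fl; have E y : \sum_i (F i y - F i x) / (y - x) =
  (\sum_i F i y - \sum_i F i x) / (y - x) by rewrite -sumrB mulr_suml.
rewrite /is_derive_in -(eq_cvg _ _ E).
by apply: cvg_big => [|i _]; [exact: add_continuous|exact: Fl].
Qed.

(** Take the supremum of the times up to [b] at which [w] lies under a line of slope slightly above
    [c]. By continuity it is such a time, and the one-sided hypothesis pushes past it unless it is
    [b]. *)
Lemma dini_le w a b c : a <= b -> {within `[a, b], continuous w} ->
  (forall t, a <= t < b -> forall e, 0 < e ->
    \forall s \near t^'+, w s <= w t + (c + e) * (s - t)) ->
  w b <= w a + c * (b - a).
Proof.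
move=> ab /subspace_continuousP wc wD; apply/ler_addgt0Pr => e e0.
(* The extra slope costs at most [e] over the whole interval; the [+ 1] covers [a = b]. *)
pose k := c + e / (b - a + 1).
suff : w b <= w a + k * (b - a).
  have -> : k * (b - a) = c * (b - a) + e * ((b - a) / (b - a + 1)).
    by rewrite /k; field; lra.
  move=> /le_trans; apply; rewrite addrA lerD2l ler_piMr ?(ltW e0)//.
  by rewrite ler_pdivrMr; lra.
pose S := [set t | a <= t <= b /\ w t <= w a + k * (t - a)].
have Sa : S a by rewrite /S /= lexx ab subrr mulr0 addr0.
have ubS : ubound S b by move=> t [/andP[]].
have supS : has_sup S by split; [exists a | exists b].
have sa : a <= sup S by apply: ub_le_sup => //; exists b.
have sb : sup S <= b by apply: ge_sup => //; exists a.
have ws : w (sup S) <= w a + k * (sup S - a).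
  (* If [w] exceeded the line by [D > 0] at [sup S], then from a point of [S] close enough to
     [sup S], both [w] and the line would change by less than [D / 2], a contradiction. *)
  rewrite leNgt; apply/negP => wlt.
  have := wc (sup S); rewrite /= in_itv /= sa sb => /(_ erefl) /cvgrPdist_lt.
  pose D := w (sup S) - (w a + k * (sup S - a)).
  have D0 : 0 < D by rewrite /D subr_gt0.
  move=> /(_ (D / 2)); rewrite divr_gt0// => /(_ erefl)/nbhs_ballP[d /= d0 dS].
  have k0 : 0 < `|k| + 1 by have := normr_ge0 k; lra.
  have e1 : 0 < Num.min d (D / 2 / (`|k| + 1)).
    by rewrite lt_min d0 !divr_gt0.
  have [t St] := sup_adherent e1 supS; rewrite ltrBlDr => st.
  have ts : t <= sup S by apply: ub_le_sup => //; exists b.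
  have [tab wt] := St.
  have := dS t; rewrite /= -ball_normE /= in_itv /= tab ger0_norm ?subr_ge0//.
  have : sup S - t < Num.min d (D / 2 / (`|k| + 1)) by lra.
  rewrite lt_min => /andP[-> std] /(_ erefl erefl) /ltr_normlW.
  have : k * (t - sup S) <= `|k| * (sup S - t).
    rewrite -(ger0_norm (x := sup S - t)) ?subr_ge0// -normrM.
    by rewrite -normrN -mulrN opprB ler_norm.
  move: std; rewrite ltr_pdivlMr// mulrC mulrDl => std.
  by rewrite /from_subspace {}/D in D0 dS e1 std st *; move: wlt wt; clearbody k; lra.
have [sltb|] := ltP (sup S) b; last first.
  by move=> bs; have <- : sup S = b by apply/le_anti; rewrite sb bs.
exfalso.
have e'0 : 0 < e / (b - a + 1) by rewrite divr_gt0//; lra.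
have := wD (sup S); rewrite sa sltb => /(_ erefl _ e'0) H.
near (sup S)^'+ => s.
have ss : sup S < s by near: s; exact: nbhs_right_gt.
have : S s.
  split; first by rewrite (le_trans sa (ltW ss))/=; apply/ltW; near: s; exact: nbhs_right_lt.
  have : w s <= w (sup S) + (c + e / (b - a + 1)) * (s - sup S) by near: s.
  by rewrite -/k => /le_trans; apply; lra.
by move=> /(ub_le_sup (ex_intro _ b ubS)); rewrite leNgt ss.
Unshelve. all: by end_near.
Qed.

(** Apply [dini_le] to [|f t - f a|]: by the triangle inequality it grows to the right of [t] at a
    rate at most [|d t| + e]. *)
Lemma mean_value_inequality f d a b c : a <= b ->
  (forall t, a <= t <= b -> is_derive_in `[a, b] f t (d t)) ->
  (forall t, a <= t <= b -> `|d t| <= c) -> `|f b - f a| <= c * (b - a).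
Proof.
move=> ab fd dc; have := @dini_le (fun t => `|f t - f a|) a b c ab.
rewrite subrr normr0 add0r; apply.
  apply/subspace_continuousP => t; rewrite /= in_itv /= => tab.
  apply: cvg_norm; apply: cvgB; last exact: cvg_cst.
  exact/is_derive_in_continuous/fd.
move=> t /andP[a_t tb] e e0; have tab : a <= t <= b by rewrite a_t ltW.
have /nbhs_ballP[r /= r0 Hr] := is_derive_in_bound (fd _ tab) e0.
near=> s; have ts : t < s by near: s; exact: nbhs_right_gt.
have sb : s < b by near: s; exact: nbhs_right_lt.
have /= := Hr s; rewrite -ball_normE /= in_itv /= (le_trans a_t (ltW ts)) (ltW sb).
rewrite distrC gtr0_norm ?subr_gt0// => /(_ _ erefl) H.
have {}H : `|f s - f t - d t * (s - t)| <= e * (s - t).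
  by apply: H; rewrite ltrBlDl; near: s; apply: nbhs_right_lt; rewrite ltrDl.
have -> : f s - f a = (f t - f a) + d t * (s - t) + (f s - f t - d t * (s - t)) by ring.
apply: (le_trans (ler_normD _ _)); rewrite mulrDl addrA lerD//.
apply: (le_trans (ler_normD _ _)); rewrite lerD2l normrM (gtr0_norm (x := s - t)) ?subr_gt0//.
by rewrite ler_wpM2r ?subr_ge0 ?(ltW ts)// dc.
Unshelve. all: by end_near.
Qed.

End derivatives_relative_to_a_set.

(** * The l1 norm and its growth along linear equations driven by generators *)

Section l1_norm.
Variables (R : realType) (n : nat).
Implicit Types (u v r : 'rV[R]_n) (B Q : 'M[R]_n).

Definition l1_norm u : R := \sum_i `|u 0 i|.

Lemma tv_distE u v : tv_dist u v = 2^-1 * l1_norm (u - v).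
Proof. by rewrite /tv_dist; congr (_ * _); apply: eq_bigr => i _; rewrite !mxE. Qed.

Lemma ler_l1_normD u v : l1_norm (u + v) <= l1_norm u + l1_norm v.
Proof. by rewrite -big_split; apply: ler_sum => i _; rewrite mxE ler_normD. Qed.

Lemma l1_norm0 : l1_norm 0 = 0.
Proof. by rewrite /l1_norm big1// => i _; rewrite mxE normr0. Qed.

Lemma l1_normN u : l1_norm (- u) = l1_norm u.
Proof. by apply: eq_bigr => i _; rewrite mxE normrN. Qed.

Lemma l1_normZ a u : l1_norm (a *: u) = `|a| * l1_norm u.
Proof. by rewrite mulr_sumr; apply: eq_bigr => i _; rewrite mxE normrM. Qed.

Lemma ler_l1_norm_mul u B c : (forall i, \sum_j `|B i j| <= c) ->
  l1_norm (u *m B) <= l1_norm u * c.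
Proof.
move=> Bc; apply: (@le_trans _ _ (\sum_j \sum_i `|u 0 i| * `|B i j|)).
  apply: ler_sum => j _; rewrite mxE; apply: (le_trans (ler_norm_sum _ _ _)).
  by apply: ler_sum => i _; rewrite normrM.
rewrite exchange_big mulr_suml; apply: ler_sum => i _.
by rewrite -mulr_sumr ler_wpM2l.
Qed.

(** For small [h] the matrix [1 + h Q] is stochastic: its rows sum to 1 and its diagonal is still
    nonnegative. Its rows thus have l1 norm 1. *)
Lemma generator_step u Q : is_generator Q ->
  exists2 d, 0 < d &
    forall h, 0 <= h <= d -> l1_norm (u + h *: (u *m Q)) <= l1_norm u.
Proof.
move=> [Q0 Q1]; pose b := \sum_i `|Q i i|.
have b0 : 0 <= b by apply: sumr_ge0.
(* Since [- Q i i <= b], this choice keeps [1 + h * Q i i] nonnegative. *)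
exists (b + 1)^-1 => [|h /andP[h0 hb]]; first by rewrite invr_gt0; lra.
have {}hb : h * (b + 1) <= 1 by rewrite -ler_pdivlMr ?div1r//; lra.
have -> : u + h *: (u *m Q) = u *m (1%:M + h *: Q).
  by rewrite mulmxDr mulmx1 -scalemxAr.
rewrite -[leRHS]mulr1; apply: ler_l1_norm_mul => i.
rewrite (eq_bigr (fun j => (1%:M : 'M[R]_n) i j + h * Q i j)) => [|j _].
  rewrite big_split /= -mulr_sumr Q1 mulr0 addr0 (bigD1 i)//= mxE eqxx.
  by rewrite big1 ?addr0// => j ji; rewrite mxE eq_sym (negbTE ji).
rewrite !mxE ger0_norm//; have [<-|ij] := eqVneq i j; last first.
  by rewrite add0r mulr_ge0 ?Q0.
have Qb : - Q i i <= b.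
  rewrite (le_trans (ler_norm _))// normrN /b (bigD1 i)//= lerDl.
  by apply: sumr_ge0.
by rewrite /=; nra.
Qed.

Lemma cvg_l1_norm (T : Type) (F : set_system T) {FF : Filter F}
    (u : T -> 'rV[R]_n) (l : 'rV[R]_n) :
  (forall i, u x 0 i @[x --> F] --> l 0 i) ->
  l1_norm (u x) @[x --> F] --> l1_norm l.
Proof.
move=> ul; apply: cvg_big => [|i _]; first exact: add_continuous.
by apply: cvg_norm; exact: ul.
Qed.

End l1_norm.

(** Up to [o(h)], [u (t + h)] is the Euler step [u t (1 + h Q) + h r t]. The first term does not
    increase the norm, the second adds at most [c h], and [dini_le] concludes. *)
Lemma l1_norm_growth (R : realType) n (u r : R -> 'rV[R]_n) (Q : R -> 'M[R]_n)
    (a b c : R) : a <= b ->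
  (forall t, a <= t <= b -> is_generator (Q t)) ->
  (forall t, a <= t <= b -> forall i,
    is_derive_in `[a, b] (fun s => u s 0 i) t ((u t *m Q t + r t) 0 i)) ->
  (forall t, a <= t <= b -> l1_norm (r t) <= c) ->
  l1_norm (u b) <= l1_norm (u a) + c * (b - a).
Proof.
move=> ab Qg ud rc; apply: (@dini_le _ (fun t => l1_norm (u t))) => //.
  apply/subspace_continuousP => t; rewrite /= in_itv /= => tab.
  by apply: cvg_l1_norm => i; exact/is_derive_in_continuous/ud.
move=> t /andP[a_t tb] e e0; have tab : a <= t <= b by rewrite a_t ltW.
(* The [n] coordinatewise errors [e' (s - t)] then add up to at most [e (s - t)]. *)
pose d := u t *m Q t + r t; pose e' := e / (n%:R + 1).
have e'0 : 0 < e' by rewrite divr_gt0// ltr_wpDl.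
have /nbhs_ballP[q /= q0 Hq] : \forall s \near within `[a, b] (nbhs t), forall i,
    `|u s 0 i - u t 0 i - d 0 i * (s - t)| <= e' * `|s - t|.
  by apply: filter_forall => i; have := is_derive_in_bound (ud _ tab i) e'0; apply.
have [p p0 step] := generator_step (u t) (Qg _ tab).
near=> s; have ts : t < s by near: s; exact: nbhs_right_gt.
have sb : s < b by near: s; exact: nbhs_right_lt.
have sts : `|s - t| = s - t by rewrite gtr0_norm ?subr_gt0.
have stq : ball t q s.
  rewrite -ball_normE /= distrC sts ltrBlDl.
  by near: s; apply: nbhs_right_lt; rewrite ltrDl.
have sab : (`[a, b]%classic : set R) s by rewrite /= in_itv /= (le_trans a_t (ltW ts)) ltW.
have := Hq s stq sab; rewrite sts => {}Hq.
have -> : u s = (u t + (s - t) *: (u t *m Q t)) + ((s - t) *: r t + (u s - u t - (s - t) *: d)).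
  by rewrite /d scalerDr; apply/rowP => i; rewrite !mxE; ring.
apply: (le_trans (ler_l1_normD _ _)); apply: lerD.
  apply: step; rewrite subr_ge0 (ltW ts) lerBlDl.
  by near: s; apply: nbhs_right_le; rewrite ltrDl.
apply: (le_trans (ler_l1_normD _ _)); rewrite mulrDl; apply: lerD.
  by rewrite l1_normZ sts mulrC ler_wpM2r ?rc// subr_ge0 ltW.
apply: (@le_trans _ _ (\sum_(i < n) e' * (s - t))).
  apply: ler_sum => i _; have -> : (u s - u t - (s - t) *: d) 0 i =
      u s 0 i - u t 0 i - d 0 i * (s - t) by rewrite !mxE [(s - t) * _]mulrC.
  exact: Hq.
rewrite sumr_const card_ord -mulr_natl mulrA ler_wpM2r ?subr_ge0 ?(ltW ts)//.
rewrite /e' mulrCA ler_piMr ?(ltW e0)// ler_pdivrMr ?ltr_wpDl// mul1r.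
by rewrite lerDl.
Unshelve. all: by end_near.
Qed.

(** * The matrix exponential as a power series and its derivative *)

Section exponential_of_a_matrix.
Variables (R : realType) (n : nat).
Implicit Types (A : 'M[R]_n) (i j : 'I_n) (x t : R) (k : nat).

Definition exp_mx_coeff A i j : R^nat := fun k => (A ^+ k) i j / k`!%:R.

Lemma exp_mx_series A t i j :
  exp_mx (t *: A) i j = limn (pseries (exp_mx_coeff A i j) t).
Proof.
rewrite mxE /pseries; congr (limn (series _)); apply/funext => k.
have -> : (t *: A) ^+ k = t ^+ k *: A ^+ k.
  elim: k => [|k ih]; first by rewrite !expr0 scale1r.
  by rewrite !exprS ih /GRing.mul /= -scalemxAl -scalemxAr scalerA.
by rewrite /exp_mx_coeff mxE /= -mulrA mulrC.
Qed.

(** Formal termwise differentiation multiplies by [A] on the right, because [A ^+ k.+1 = A ^+ k * A]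
    and [k.+1] cancels in the factorial. *)
Lemma pseries_diffs_exp_mx A i j :
  pseries_diffs (exp_mx_coeff A i j) =
  fun k => \sum_l exp_mx_coeff A i l k * A l j.
Proof.
apply/funext => k; rewrite /pseries_diffs /exp_mx_coeff exprSr mxE mulr_suml mulr_sumr.
apply: eq_bigr => l _; rewrite factS natrM invfM.
have : k.+1%:R != 0 :> R by rewrite pnatr_eq0.
have : k`!%:R != 0 :> R by rewrite pnatr_eq0 -lt0n fact_gt0.
by move=> ? ?; field; apply/andP.
Qed.

(** Comparison with the scalar exponential series at [b * |x|], where [b] bounds the l1 norm of
    every row of [A], so that the rows of [A ^+ k] have l1 norm at most [b ^+ k]. *)
Lemma exp_mx_coeff_cvg A i j x : cvgn (pseries (exp_mx_coeff A i j) x).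
Proof.
pose b := \sum_i \sum_j `|A i j|.
have Ab k : `|(A ^+ k) i j| <= b ^+ k.
  have Ai l : \sum_j `|A l j| <= b.
    by rewrite /b [leRHS](bigD1 l)//= lerDl sumr_ge0// => ? _; rewrite sumr_ge0.
  have : l1_norm (row i (A ^+ k)) <= b ^+ k.
    elim: k => [|k ih].
      rewrite expr0 /l1_norm (bigD1 i)//= !mxE eqxx normr1 big1 ?addr0// => l li.
      by rewrite !mxE eq_sym (negbTE li) normr0.
    rewrite exprSr row_mul exprSr (le_trans (ler_l1_norm_mul _ Ai))//.
    by rewrite ler_wpM2r// sumr_ge0// => ? _; rewrite sumr_ge0.
  apply: le_trans; rewrite /l1_norm (bigD1 j)//= mxE lerDl.
  by rewrite sumr_ge0.
apply: normed_cvg.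
apply: (series_le_cvg (v_ := exp_coeff (b * `|x|))) => // [k|k|k|].
- by rewrite /=.
- rewrite /exp_coeff /= divr_ge0 ?exprn_ge0// mulr_ge0// sumr_ge0// => ? _.
  exact: sumr_ge0.
- rewrite /exp_coeff /exp_mx_coeff /= !normrM normfV normrX exprMn normr_nat mulrAC.
  by rewrite ler_wpM2r ?invr_ge0// ler_wpM2r ?exprn_ge0.
exact: is_cvg_series_exp_coeff.
Qed.

Lemma pseries_mul_cvg (I : finType) (c : I -> R^nat) (d : I -> R) x :
  (forall l, cvgn (pseries (c l) x)) ->
  limn (pseries (fun k => \sum_l c l k * d l) x) = \sum_l limn (pseries (c l) x) * d l /\
  cvgn (pseries (fun k => \sum_l c l k * d l) x).
Proof.
move=> cx.
have : pseries (fun k => \sum_l c l k * d l) x @ \oo --> \sum_l limn (pseries (c l) x) * d l.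
  have -> : pseries (fun k => \sum_l c l k * d l) x = fun k => \sum_l pseries (c l) x k * d l.
    apply/funext => k; rewrite /pseries /series /=.
    under [RHS]eq_bigr do rewrite mulr_suml.
    rewrite exchange_big; apply: eq_bigr => i _; rewrite mulr_suml.
    by apply: eq_bigr => l _; ring.
  apply: cvg_big => [|l _]; first exact: add_continuous.
  exact: cvgMr_tmp (cx l).
by move=> h; split; [exact: cvg_lim|apply/cvg_ex; eexists; exact: h].
Qed.

(** Termwise differentiation asks for convergence of the first two formal derivatives as well; both
    are finite linear combinations of series already known to converge. *)
Lemma is_derive_exp_mx A i j t :
  is_derive t 1 (fun x => exp_mx (x *: A) i j) ((exp_mx (t *: A) *m A) i j).
Proof.
under eq_fun do rewrite exp_mx_series.
have c1 x l : cvgn (pseries (pseries_diffs (exp_mx_coeff A i l)) x).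
  rewrite pseries_diffs_exp_mx.
  by apply (pseries_mul_cvg _ (fun l' => @exp_mx_coeff_cvg A i l' x)).
have c2 x : cvgn (pseries (pseries_diffs (pseries_diffs (exp_mx_coeff A i j))) x).
  have -> : pseries_diffs (pseries_diffs (exp_mx_coeff A i j)) =
      fun k => \sum_l pseries_diffs (exp_mx_coeff A i l) k * A l j.
    rewrite [X in pseries_diffs X]pseries_diffs_exp_mx; apply/funext => k.
    by rewrite {1}/pseries_diffs mulr_sumr; apply: eq_bigr => l _; rewrite mulrA.
  by apply (pseries_mul_cvg _ (fun l => c1 x l)).
have -> : (exp_mx (t *: A) *m A) i j =
    limn (pseries (pseries_diffs (exp_mx_coeff A i j)) t).
  rewrite pseries_diffs_exp_mx mxE.
  have [-> _] := pseries_mul_cvg (A^~ j) (fun l => @exp_mx_coeff_cvg A i l t).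
  by apply: eq_bigr => l _; rewrite exp_mx_series.
apply: (pseries_snd_diffs (K := `|t| + 1)) => //; first exact: exp_mx_coeff_cvg.
by rewrite [ltRHS]ger0_norm ?addr_ge0// ltrDl.
Qed.

Lemma exp_mx0 A : exp_mx (0 *: A) = 1%:M.
Proof.
apply/matrixP => i j; rewrite exp_mx_series; apply/cvg_lim => //.
apply/cvg_ballP => e e0; exists 1%N => //= k; rewrite /= => k0.
have -> : pseries (exp_mx_coeff A i j) 0 k = 1%:M i j; last exact: ballxx.
rewrite /pseries /series /= -(prednK k0) big_nat_recl// big1 ?addr0.
  by rewrite /exp_mx_coeff !expr0 fact0 divr1 mulr1.
by move=> l _; rewrite expr0n mulr0.
Qed.

End exponential_of_a_matrix.

(** * Order of contact of the interpolating function with its value at 1 *)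

Section flatness_at_the_right_end_point.
Variable R : realType.
Implicit Types (phi : R -> R) (m k : nat) (x s : R).

(** Properness makes limits along [[0, 1]] unique, so that [derive_in], defined by [lim], is the
    derivative whenever one exists. *)
Lemma within_dnbhs_proper x :
  0 <= x <= 1 -> ProperFilter (within (`[0, 1] : set R) x^').
Proof.
move=> /andP[x0 x1]; split; last exact: within_filter.
rewrite /within /= => /nbhs_ballP[d /= d0 dA].
have bx y : `|x - y| < d -> x != y -> 0 <= y <= 1 -> False.
  by move=> xy nxy y01; apply: (dA y) => //; rewrite eq_sym.
pose e := Num.min (d / 2) (1 / 2).
have e0 : 0 < e by rewrite lt_min !divr_gt0.
have ed : e < d by rewrite gt_min ltr_pdivrMr// ltr_pMr// ltr1n.
have e2 : e <= 1 / 2 by rewrite ge_min lexx orbT.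
have [xh|xh] := leP x (1 / 2).
  apply: (bx (x + e)); last by lra.
    by rewrite opprD addNKr normrN gtr0_norm.
  by apply/eqP; lra.
apply: (bx (x - e)); last by lra.
  by rewrite opprB addrC subrK gtr0_norm.
by apply/eqP; lra.
Qed.

Lemma derivable_in_is_derive_in (f : R -> R) x : 0 <= x <= 1 ->
  derivable_in `[0, 1] f x -> is_derive_in `[0, 1] f x (derive_in `[0, 1] f x).
Proof.
move=> /within_dnbhs_proper x01 [l fl].
have -> // : derive_in `[0, 1] f x = l by exact: cvg_lim fl.
Qed.

(** The derivative of order [m] is bounded near 1. Integrating [m] times down from 1, where the
    intermediate derivatives vanish, gains one factor [1 - s] each time. *)
Lemma flat_at_1 phi m : (0 < m)%N -> Ck_in_near `[0, 1] m.+1 phi 1 ->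
  (forall k, (1 <= k < m)%N -> derive_inn `[0, 1] k phi 1 = 0) ->
  exists C d : R, [/\ 0 < C, 0 < d <= 1 &
    forall s, 1 - d <= s <= 1 -> `|phi 1 - phi s| <= C * (1 - s) ^+ m].
Proof.
move=> m0 /nbhs_ballP[r /= r0 phiC] phi0.
have phiD j x : 0 <= x <= 1 -> 1 - r < x -> (j <= m)%N ->
    is_derive_in `[0, 1] (derive_inn `[0, 1] j phi) x (derive_inn `[0, 1] j.+1 phi x).
  move=> x01 rx jm; apply: derivable_in_is_derive_in => //.
  have /andP[x0 x1] := x01.
  have := phiC x; rewrite /= -ball_normE /= in_itv /= ger0_norm ?subr_ge0//.
  rewrite ltrBlDr -ltrBlDl => /(_ rx x01)[+ _]; exact.
have in01 : 0 <= (1 : R) <= 1 by rewrite ler01 lexx.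
have /is_derive_in_continuous/cvgrPdist_le : is_derive_in `[0, 1]
    (derive_inn `[0, 1] m phi) 1 (derive_inn `[0, 1] m.+1 phi 1).
  by apply: phiD => //; lra.
move=> /(_ _ ltr01)/nbhs_ballP[q /= q0 Hq].
pose d := Num.min (Num.min (r / 2) (q / 2)) 1.
have d0 : 0 < d by rewrite !lt_min ltr01 !divr_gt0.
have d1 : d <= 1 by rewrite ge_min lexx orbT.
have dr : d < r.
  by rewrite gt_min gt_min ltr_pdivrMr// ltr_pMr// ltr1n.
have dq : d < q.
  by rewrite gt_min gt_min [q / 2 < q]ltr_pdivrMr// ltr_pMr// ltr1n orbT.
(* By continuity at 1, the derivative of order [m] is within 1 of its value at 1 on [[1 - d, 1]], so
   [M] bounds it there. *)
pose M := `|derive_inn `[0, 1] m phi 1| + 1.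
have M0 : 0 < M by rewrite ltr_wpDl.
have step j k : (j <= m)%N ->
    (forall s, 1 - d <= s <= 1 -> `|derive_inn `[0, 1] j.+1 phi s| <= M * (1 - s) ^+ k) ->
    forall s, 1 - d <= s <= 1 ->
    `|derive_inn `[0, 1] j phi 1 - derive_inn `[0, 1] j phi s| <= M * (1 - s) ^+ k.+1.
  move=> jm Hk s /andP[ds s1]; rewrite exprSr mulrA.
  apply: (mean_value_inequality (d := derive_inn `[0, 1] j.+1 phi)) => // t /andP[st t1].
    apply: (@is_derive_in_subset _ _ `[0, 1]); last by apply: phiD => //; lra.
    by move=> y /=; rewrite !in_itv /=; lra.
  apply: (le_trans (Hk _ _)); first by lra.
  by rewrite ler_pM2l// lerXn2r// ?nnegrE; lra.
exists M, d; rewrite d0 d1; split => // s sd.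
rewrite -[X in _ ^+ X](prednK m0); apply: (step 0%N) => // {sd}s.
(* The induction on [k < m] shows that the derivative of order [m - k] is bounded by
   [M (1 - s) ^+ k]; the case [k = m.-1] is the one wanted. *)
have -> : 1%N = (m - m.-1)%N by lia.
have : (m.-1 < m)%N by rewrite prednK.
elim: m.-1 s => [|k ih] s km sd.
  rewrite subn0 expr0 mulr1.
  have := Hq s; rewrite /= -ball_normE /= in_itv /= => /(_ _ _) H.
  have : `|derive_inn `[0, 1] m phi 1 - derive_inn `[0, 1] m phi s| <= 1.
    by apply: H; [rewrite ger0_norm; lra|lra].
  by rewrite distrC /M -lerBlDl; move=> h; apply: (le_trans (lerB_dist _ _) h).
have := @step (m - k.+1)%N k (leq_subr _ _) _ s sd.
have -> : derive_inn `[0, 1] (m - k.+1) phi 1 = 0.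
  by apply: phi0; apply/andP; split; lia.
rewrite sub0r normrN subnSK ?(ltnW km)//; apply => t; apply: ih.
exact: ltnW.
Qed.

(** Where [1 - s > d], the trivial bound 1 is at most [((1 - s) / d) ^+ m]. The conditions on the
    values of [phi] come after the constant because they are known only once a chain is given,
    whereas the constant must precede it. *)
Lemma flat_at_1_global phi m : (0 < m)%N -> Ck_in_near `[0, 1] m.+1 phi 1 ->
  (forall k, (1 <= k < m)%N -> derive_inn `[0, 1] k phi 1 = 0) ->
  exists2 C : R, 0 < C & phi 1 = 1 -> (forall s, 0 <= s <= 1 -> 0 <= phi s) ->
    forall s, 0 <= s <= 1 -> 1 - phi s <= C * (1 - s) ^+ m.
Proof.
move=> m0 phiC phi0; have [C [d [C0 /andP[d0 d1] H]]] := flat_at_1 m0 phiC phi0.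
exists (C + d^-1 ^+ m) => [|phi1 phige s /andP[s0 s1]].
  by rewrite addr_gt0// exprn_gt0// invr_gt0.
rewrite mulrDl; have [ds|sd] := leP (1 - d) s.
  have := H s; rewrite ds s1 phi1 => /(_ erefl)/ler_normlW/le_trans; apply.
  by rewrite lerDl -exprMn exprn_ge0// mulr_ge0 ?invr_ge0 ?subr_ge0// ltW.
apply: (@le_trans _ _ 1); first by rewrite gerBl phige ?s0.
rewrite -exprMn -[leLHS]add0r lerD ?mulr_ge0 ?exprn_ge0 ?subr_ge0 ?(ltW C0)//.
by rewrite exprn_ege1// ler_pdivlMl// mulr1; lra.
Qed.

End flatness_at_the_right_end_point.

(** * Perturbation and mixing estimates for Markov chains *)

Section markov_chains.
Variables (R : realType) (n : nat).
Implicit Types (nu pi : 'rV[R]_n) (A Q : 'M[R]_n) (G : R -> 'M[R]_n).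
Implicit Types (P : R -> R -> 'M[R]_n) (lam t T c : R).

Lemma is_distr_delta (i : 'I_n) : is_distr (delta_mx 0 i : 'rV[R]_n).
Proof.
split=> [j|]; first by rewrite mxE ler0n.
by rewrite (bigD1 i)//= mxE !eqxx big1 ?addr0// => j ji; rewrite mxE (negbTE ji) andbF.
Qed.

Lemma l1_norm_distr nu : is_distr nu -> l1_norm nu = 1.
Proof. by move=> [nu0 <-]; apply: eq_bigr => i _; rewrite ger0_norm. Qed.

(** A negative entry would make the sum of the absolute values strictly larger than the sum of the
    entries. *)
Lemma is_distr_l1_norm nu : l1_norm nu <= 1 -> \sum_i nu 0 i = 1 -> is_distr nu.
Proof.
move=> nu1 snu; split=> // i; rewrite leNgt; apply/negP => nui.
move: nu1; rewrite leNgt -snu => /negP; apply.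
rewrite /l1_norm (bigD1 i)//= [ltRHS](bigD1 i)//= ltr_leD//.
  by rewrite (lt_le_trans nui).
by apply: ler_sum => j _; exact: ler_norm.
Qed.

(** The diagonal entry is minus the sum of the others, so it at most doubles the total. *)
Lemma sum_norm_row A lam i : \sum_j A i j = 0 ->
  \sum_(j | j != i) `|A i j| <= lam -> \sum_j `|A i j| <= 2 * lam.
Proof.
move=> A0 Alam; rewrite (bigD1 i)//=; move: A0; rewrite (bigD1 i)//= => /eqP.
rewrite addr_eq0 => /eqP ->; rewrite normrN.
by have := ler_norm_sum (index_enum 'I_n) (fun j => A i j) (predC1 i); rewrite /=; lra.
Qed.

Lemma sum_norm_generator Q lam i : is_generator Q ->
  \sum_(j | j != i) Q i j <= lam -> \sum_j `|Q i j| <= 2 * lam.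
Proof.
move=> [Q0 Q1] Ql; apply: sum_norm_row => //.
rewrite (le_trans _ Ql)//; apply: ler_sum => j ji.
by rewrite ger0_norm// Q0// eq_sym.
Qed.

Lemma is_derive_in_mul_row (D : set R) (M : R -> 'M[R]_n) (M' : 'M[R]_n) nu t i :
  (forall i j, is_derive_in D (fun s => M s i j) t (M' i j)) ->
  is_derive_in D (fun s => (nu *m M s) 0 i) t ((nu *m M') 0 i).
Proof.
move=> MM'; apply: (is_derive_in_ext (f := fun s => \sum_k nu 0 k * M s k i)).
- by move=> s; rewrite mxE.
- by rewrite mxE.
by apply: is_derive_in_sum => k; exact: is_derive_inMl.
Qed.

Lemma is_derive_in_exp_row (D : set R) nu Q a t i :
  is_derive_in D (fun s => (nu *m exp_mx ((s - a) *: Q)) 0 i) t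
    ((nu *m exp_mx ((t - a) *: Q) *m Q) 0 i).
Proof.
rewrite -mulmxA; apply: is_derive_in_mul_row => k l.
apply: is_derive_is_derive_in; rewrite -[X in is_derive _ _ _ X]mulr1.
apply: (@is_derive1_comp _ (fun x => exp_mx (x *: Q) k l) (fun s => s - a)).
  exact: is_derive_exp_mx.
by apply: is_derive_eq; rewrite subr0.
Qed.

(** The difference starts at 0 and solves [u' = u Q + nu Q], whose source has l1 norm at most
    [2 * lam]. *)
Lemma exp_mx_slow Q lam nu t : is_generator Q ->
  (forall i, \sum_(j | j != i) Q i j <= lam) -> is_distr nu -> 0 <= t ->
  l1_norm (nu *m exp_mx (t *: Q) - nu) <= 2 * lam * t.
Proof.
move=> Qg Ql nud t0.
have := @l1_norm_growth _ _ (fun s => nu *m exp_mx ((s - 0) *: Q) - nu)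
  (fun=> nu *m Q) (fun=> Q) 0 t (2 * lam) t0.
rewrite !subr0 exp_mx0 mulmx1 subrr.
rewrite l1_norm0 add0r; apply => // [s _ i|s _].
  rewrite mulmxBl subrK; apply: (is_derive_in_ext
    (f := fun s => (nu *m exp_mx ((s - 0) *: Q)) 0 i - nu 0 i)
    (l := (nu *m exp_mx ((s - 0) *: Q) *m Q) 0 i - 0)).
  - by move=> x; rewrite !mxE.
  - by rewrite !subr0.
  by apply: is_derive_inB; [exact: is_derive_in_exp_row|exact: is_derive_in_cst].
apply: (le_trans (ler_l1_norm_mul (c := 2 * lam) _ _)) => [i|].
  exact: sum_norm_generator.
by rewrite (l1_norm_distr nud) mul1r.
Qed.

Lemma is_derive_in_transition T G P nu t i : is_transition T G P -> 0 <= t <= T ->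
  is_derive_in `[0, T] (fun s => (nu *m P 0 s) 0 i) t ((nu *m P 0 t *m G t) 0 i).
Proof.
move=> PT t0T; have /andP[t0 tT] := t0T; rewrite -mulmxA; apply: is_derive_in_mul_row => k l.
have z0T : 0 <= (0 : R) <= T by rewrite lexx (le_trans t0).
by have [_ /(_ t t0T)] := PT 0 z0T; exact.
Qed.

(** The l1 norm does not grow, by [l1_norm_growth] without source, and the total mass is constant
    since generators have zero row sums; [is_distr_l1_norm] then gives nonnegativity. *)
Lemma is_distr_transition T G P nu t : is_transition T G P ->
  (forall s, 0 <= s <= T -> is_generator (G s)) -> is_distr nu ->
  0 <= t <= T -> is_distr (nu *m P 0 t).
Proof.
move=> PT Gg nud /andP[t0 tT].
have P0 : P 0 0 = 1%:M.
  have z0T : 0 <= (0 : R) <= T by rewrite lexx (le_trans t0).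
  by have [] := PT 0 z0T.
have der s i : 0 <= s <= t ->
    is_derive_in `[0, t] (fun s => (nu *m P 0 s) 0 i) s ((nu *m P 0 s *m G s) 0 i).
  move=> /andP[s0 st]; apply: (@is_derive_in_subset _ _ `[0, T]).
    by move=> x; rewrite /= !in_itv /= => /andP[-> /le_trans]; apply.
  by apply: is_derive_in_transition => //; rewrite s0 (le_trans st).
have G't s : 0 <= s <= t -> is_generator (G s).
  by move=> /andP[s0 st]; apply: Gg; rewrite s0 (le_trans st).
apply: is_distr_l1_norm.
  have := @l1_norm_growth _ _ (fun s => nu *m P 0 s) (fun=> 0) G 0 t 0 t0 G't.
  rewrite P0 mulmx1 mul0r addr0 (l1_norm_distr nud); apply=> [s st i|s _].
    by rewrite addr0; exact: der.
  by rewrite l1_norm0.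
have := @mean_value_inequality _ (fun s => \sum_i (nu *m P 0 s) 0 i) (fun=> 0) 0 t 0 t0.
rewrite mul0r P0 mulmx1 nud.2 => H; apply/eqP; rewrite -subr_eq0 -normr_le0.
apply: H => [s st|s _]; last by rewrite normr0.
apply: (is_derive_in_ext (f := fun s => \sum_i (nu *m P 0 s) 0 i)
    (l := \sum_i (nu *m P 0 s *m G s) 0 i)) => //.
  under eq_bigr do rewrite mxE.
  rewrite exchange_big big1// => k _; rewrite -mulr_sumr.
  by rewrite (G't _ st).2 mulr0.
by apply: is_derive_in_sum => i; exact: der.
Qed.

(** The difference of the two evolutions vanishes at time [a] and solves
    [u' = u Q + nu P(0, s) (G s - Q)]. The source has norm at most [c] because [nu P(0, s)] is a
    distribution. *)
Lemma transition_exp_mx T G P Q nu a c : is_transition T G P ->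
  (forall s, 0 <= s <= T -> is_generator (G s)) -> is_generator Q ->
  is_distr nu -> 0 <= a <= T ->
  (forall s i, a <= s <= T -> \sum_j `|(G s - Q) i j| <= c) ->
  l1_norm (nu *m P 0 T - nu *m P 0 a *m exp_mx ((T - a) *: Q)) <= c * (T - a).
Proof.
move=> PT Gg Qg nud /andP[a0 aT] GQ; pose q := nu *m P 0 a.
have := @l1_norm_growth _ _ (fun s => nu *m P 0 s - q *m exp_mx ((s - a) *: Q))
  (fun s => nu *m P 0 s *m (G s - Q)) (fun=> Q) a T c aT.
rewrite subrr exp_mx0 mulmx1 subrr.
rewrite l1_norm0 add0r; apply => // [s /andP[st sT] i|s /andP[st sT]].
  apply: (is_derive_in_ext (f := fun s => (nu *m P 0 s) 0 i - (q *m exp_mx ((s - a) *: Q)) 0 i)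
    (l := (nu *m P 0 s *m G s) 0 i - (q *m exp_mx ((s - a) *: Q) *m Q) 0 i)).
  - by move=> x; rewrite !mxE.
  - have -> : (nu *m P 0 s - q *m exp_mx ((s - a) *: Q)) *m Q + nu *m P 0 s *m (G s - Q) =
        nu *m P 0 s *m G s - q *m exp_mx ((s - a) *: Q) *m Q.
      by rewrite mulmxBl mulmxBr addrC addrA subrK.
    by rewrite [RHS]mxE [X in _ = _ + X]mxE.
  apply: is_derive_inB; last exact: is_derive_in_exp_row.
  apply: (@is_derive_in_subset _ _ `[0, T]).
    by move=> x; rewrite /= !in_itv /= => /andP[ax ->]; rewrite (le_trans a0).
  by apply: is_derive_in_transition; rewrite // sT (le_trans a0).
apply: (le_trans (ler_l1_norm_mul (c := c) _ _)) => [i|]; first by apply: GQ; rewrite st.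
rewrite l1_norm_distr ?mul1r//; apply: (is_distr_transition PT) => //.
by rewrite sT (le_trans a0).
Qed.

(** Two point masses are at l1 distance 2, yet each lies within [eps + 2 * lam * t] of [pi]: it
    moves little by time [t] and is then nearly mixed. *)
Lemma mixing_time_lb Q pi lam t eps : (1 < n)%N -> is_generator Q ->
  (forall i, \sum_(j | j != i) Q i j <= lam) -> 0 <= t -> eps <= 2^-1 ->
  (forall nu, is_distr nu -> tv_dist (nu *m exp_mx (t *: Q)) pi <= eps / 2) ->
  4^-1 <= lam * t.
Proof.
move=> n1 Qg Ql t0 e2 mix.
pose d (i : 'I_n) : 'rV[R]_n := delta_mx 0 i.
have close i : l1_norm (d i - pi) <= eps + 2 * lam * t.
  have di := is_distr_delta i; have := mix _ di; rewrite tv_distE => mixi.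
  have := exp_mx_slow Qg Ql di t0; rewrite -l1_normN opprB => slow.
  rewrite (_ : d i - pi = (d i - d i *m exp_mx (t *: Q)) + (d i *m exp_mx (t *: Q) - pi)).
    by apply: (le_trans (ler_l1_normD _ _)); move: mixi slow; rewrite -/(d i); lra.
  by rewrite addrA subrK.
pose i0 : 'I_n := Ordinal (ltnW n1); pose i1 : 'I_n := Ordinal n1.
have : 2 <= l1_norm (d i0 - d i1).
  rewrite /l1_norm (bigD1 i0)//= (bigD1 i1)//= !mxE /= subr0 sub0r normrN !normr1.
  by rewrite addrA lerDl sumr_ge0.
have -> : d i0 - d i1 = (d i0 - pi) - (d i1 - pi) by rewrite opprB addrA subrK.
move/le_trans => /(_ _ (ler_l1_normD _ _)); rewrite l1_normN.
by have := close i0; have := close i1; lra.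
Qed.

(** With [lam = 0] nothing moves, so two distinct point masses would both be stationary. *)
Lemma rate_gt0 Q pi lam : (1 < n)%N -> is_generator Q ->
  (forall i, \sum_(j | j != i) Q i j <= lam) -> is_unique_stationary Q pi ->
  0 < lam.
Proof.
move=> n1 Qg Ql [_ piU]; pose i0 : 'I_n := Ordinal (ltnW n1); pose i1 : 'I_n := Ordinal n1.
have lam0 : 0 <= lam.
  by apply: le_trans (Ql i0); apply: sumr_ge0 => j ji; rewrite Qg.1// eq_sym.
rewrite lt_def lam0 andbT; apply/negP => /eqP lam00.
have st i : is_stationary Q (delta_mx 0 i).
  split=> [|t t0]; first exact: is_distr_delta.
  have := exp_mx_slow Qg Ql (is_distr_delta i) t0; rewrite lam00 mulr0 mul0r.
  set v := _ - _ => v0; apply/eqP; rewrite -subr_eq0 -/v; apply/eqP/rowP => j.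
  apply/eqP; rewrite [X in _ == X]mxE -normr_le0 (le_trans _ v0)// /l1_norm (bigD1 j)//= lerDl.
  by rewrite sumr_ge0.
have := piU _ (st i0); rewrite -(piU _ (st i1)) => /rowP/(_ i0).
by rewrite !mxE /= => /eqP; rewrite oner_eq0.
Qed.

Section interpolation.
Variables (phis : 'I_n -> 'I_n -> R -> R) (Qi Qf : 'M[R]_n).
Hypotheses (Qig : is_generator Qi) (Qfg : is_generator Qf).

Lemma interp_gen_generator s :
  (forall i j, i != j -> 0 <= phis i j s <= 1) ->
  is_generator (interp_gen phis Qi Qf s).
Proof.
move=> phi01; split=> [i j ij|i].
  rewrite mxE (negbTE ij); have /andP[p0 p1] := phi01 _ _ ij.
  by rewrite addr_ge0// mulr_ge0 ?subr_ge0 ?Qig.1 ?Qfg.1.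
rewrite (bigD1 i)//= mxE eqxx addrC; apply/eqP; rewrite subr_eq0; apply/eqP.
by apply: eq_bigr => j ji; rewrite mxE eq_sym (negbTE ji).
Qed.

(** Off the diagonal the difference is [(1 - phis i j s) (Qi i j - Qf i j)], which contributes at
    most [2 * lam * c] per row; the diagonal doubles this. *)
Lemma interp_gen_dist lam s c i : 0 <= c ->
  (forall i j, i != j -> 0 <= phis i j s <= 1) ->
  (forall i j, i != j -> 1 - phis i j s <= c) ->
  \sum_(j | j != i) Qi i j <= lam -> \sum_(j | j != i) Qf i j <= lam ->
  \sum_j `|(interp_gen phis Qi Qf s - Qf) i j| <= 4 * lam * c.
Proof.
move=> c0 phi01 phic Qil Qfl.
  apply: (@le_trans _ _ (2 * (2 * lam * c))); last by lra.
  apply: sum_norm_row.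
    under eq_bigr do rewrite mxE [X in _ + X]mxE.
    by rewrite sumrB Qfg.2 (interp_gen_generator phi01).2 subrr.
  apply: (@le_trans _ _ (\sum_(j | j != i) (Qi i j + Qf i j) * c)).
    apply: ler_sum => j ji; rewrite !mxE eq_sym (negbTE ji).
    have ij : i != j by rewrite eq_sym.
    have -> : (1 - phis i j s) * Qi i j + phis i j s * Qf i j - Qf i j =
        (1 - phis i j s) * (Qi i j - Qf i j) by ring.
    have /andP[p0 p1] := phi01 _ _ ij.
    rewrite normrM ger0_norm ?subr_ge0// mulrC ler_pM ?subr_ge0 ?phic//.
    by rewrite (le_trans (ler_normB _ _))// !ger0_norm ?Qig.1 ?Qfg.1.
by rewrite -mulr_suml big_split ler_wpM2r//=; lra.
Qed.
End interpolation.

End markov_chains.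

(** * The adiabatic theorem *)

Unset Implicit Arguments.

Theorem theorem2 (R : realType) (phi : R -> R) (m : nat) :
  (0 < m)%N ->
  Ck_in_near `[0, 1] m.+1 phi 1 ->
  (forall k, (1 <= k < m)%N -> derive_inn `[0, 1] k phi 1 = 0) ->
  derive_inn `[0, 1] m phi 1 != 0 ->
  exists C eps0 : R, 0 < C /\ 0 < eps0 < 1 /\
    forall (n : nat) (Qi Qf : 'M[R]_n) (pif : 'rV[R]_n)
      (phis : 'I_n -> 'I_n -> R -> R) (lam : R)
      (P : R -> R -> R -> 'M[R]_n),
    (1 < n)%N ->
    is_generator Qi ->
    is_generator Qf ->
    is_unique_stationary Qf pif ->
    (forall i j, i != j ->
      {within `[0, 1], continuous (phis i j)} /\
      (forall s, 0 <= s <= 1 -> 0 <= phis i j s <= 1) /\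
      phis i j 0 = 0 /\ phis i j 1 = 1) ->
    (forall s, 0 <= s <= 1 -> phi s = min_offdiag phis s) ->
    (forall i, \sum_(j | j != i) Qi i j <= lam) ->
    (forall i, \sum_(j | j != i) Qf i j <= lam) ->
    (forall T, 0 < T ->
      is_transition T (fun t => interp_gen phis Qi Qf (t / T)) (P T)) ->
    forall eps : R, 0 < eps <= eps0 ->
      (adiabatic_time P pif eps <=
        C%:E * ((lam / eps) `^ (m%:R^-1))%:E *
        (t_mix Qf pif (eps / 2)) `^ (m.+1%:R / m%:R))%E.
Proof.
move=> m0 phiC phi0 _; have [C1 C10 HC] := flat_at_1_global m0 phiC phi0.
(* The summand 2 serves to prove [K <= T], and [4 * C1] absorbs the perturbation error. *)
pose C2 := 2 + 4 * C1; pose p : R := m.+1%:R / m%:R.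
have mR0 : 0 < m%:R :> R by rewrite ltr0n.
have p0 : 0 < p by rewrite divr_gt0// ltr0n.
have C20 : 0 < C2 by rewrite /C2; lra.
(* The factor [2 ^ p] pays for a mixing time [K] below twice the infimum; [eps <= 1/2] is what
   [mixing_time_lb] asks for. *)
exists (C2 * 2 `^ p), 2^-1; split; first by rewrite mulr_gt0// powR_gt0.
split; first by lra.
move=> n Qi Qf pif phis lam P n1 Qig Qfg pifU phisP phimin Qil Qfl PT eps /andP[e0 e2].
have lam0 := rate_gt0 n1 Qfg Qfl pifU.
have phis01 s : 0 <= s <= 1 -> forall i j, i != j -> 0 <= phis i j s <= 1.
  by move=> s01 i j /phisP[_ [+ _]]; exact.
have phile s : 0 <= s <= 1 -> forall i j, i != j -> phi s <= phis i j s.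
  move=> s01 i j ij; rewrite phimin// /min_offdiag.
  exact: (bigmin_le_cond _ (fun q : 'I_n * 'I_n => phis q.1 q.2 s) (j := (i, j))).
have phige s : 0 <= s <= 1 -> 0 <= phi s.
  move=> s01; rewrite phimin//; apply: le_bigmin => // -[i j] /= ij.
  by case/andP: (phis01 _ s01 _ _ ij).
have phi1 : phi 1 = 1.
  rewrite phimin ?ler01 ?lexx//; apply/le_anti; rewrite bigmin_le_id/=.
  by apply: le_bigmin => // -[i j] /= /phisP[_ [_ [_ ->]]].
have {}HC := HC phi1 phige.
have lb K : 0 <= K -> (forall nu, is_distr nu ->
    tv_dist (nu *m exp_mx (K *: Qf)) pif <= eps / 2) -> 4^-1 <= lam * K.
  by move=> K0; exact: (mixing_time_lb n1 Qfg Qfl).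
set tau := t_mix _ _ _.
have L0 : 0 < (lam / eps) `^ m%:R^-1 by rewrite powR_gt0// divr_gt0.
have : ((4 * lam)^-1%:E <= tau)%E.
  apply: le_ereal_inf_tmp => _ [K [K0 /(lb _ K0) lbK] <-].
  by rewrite lee_fin invfM ler_pdivrMr// mulrC.
(* The lower bound rules out [-oo]; for [+oo] the right-hand side is [+oo]. *)
rewrite -[m.+1%:R / m%:R]/p; case E : tau => [r| |] // rlb; last first.
  rewrite poweRyr ?gt_eqF// gt0_muley ?leey// -EFinM lte_fin.
  by rewrite mulr_gt0// mulr_gt0// powR_gt0.
have r0 : 0 < r by move: rlb; rewrite lee_fin; apply: lt_le_trans; rewrite invr_gt0 mulr_gt0.
have : (tau < (2 * r)%:E)%E by rewrite E lte_fin ltr_pMl// ltr1n.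
move=> /ereal_inf_lt[_ [K [K0 mixK] <-]]; rewrite lte_fin => Kr.
have lamK := lb _ K0 mixK.
have {}K0 : 0 < K by rewrite -(pmulr_rgt0 _ lam0); lra.
(* Chosen so that the perturbation error [4 lam C1 (K / T) ^+ m K] equals [4 C1 / C2 ^+ m * eps]. *)
pose T := C2 * (lam / eps) `^ m%:R^-1 * K `^ p.
have T0 : 0 < T by rewrite !mulr_gt0// powR_gt0.
have Tm : T ^+ m = C2 ^+ m * (lam / eps) * K ^+ m.+1.
  have -> : lam / eps = ((lam / eps) `^ m%:R^-1) ^+ m.
    rewrite -powR_mulrn ?powR_ge0// -powRrM mulVf ?gt_eqF// powRr1//.
    by rewrite divr_ge0// ltW.
  have -> : K ^+ m.+1 = (K `^ p) ^+ m.
    by rewrite -!powR_mulrn ?powR_ge0 ?(ltW K0)// -powRrM divfK ?gt_eqF.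
  by rewrite !exprMn.
have C2m : C2 <= C2 ^+ m.
  by rewrite -(prednK m0) exprS ler_pMr// exprn_ege1// /C2; lra.
(* After taking [m]-th powers this is [1 <= C2 ^+ m * (lam / eps) * K], which follows from
   [lam * K >= 1/4], [eps <= 1/2] and [C2 >= 2]. *)
have KT : K <= T.
  rewrite -(ler_pXn2r m0) ?nnegrE ?(ltW K0) ?(ltW T0)// Tm exprS mulrA ler_pMl ?exprn_gt0//.
  have : 2 * (1 / 2) <= C2 ^+ m * (lam / eps * K).
    rewrite ler_pM//; first by rewrite (le_trans _ C2m)// /C2; lra.
    by rewrite mulrAC ler_pdivlMr//; lra.
  by rewrite mulrA; lra.
apply: (@le_trans _ _ T%:E).
  apply: ereal_inf_lbound; exists T => //; split=> // nu nud.
  have gen s : 0 <= s <= T -> is_generator (interp_gen phis Qi Qf (s / T)).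
    move=> /andP[s0 sT]; apply: interp_gen_generator => //; apply: phis01.
    by rewrite divr_ge0 ?(ltW T0)//= ler_pdivrMr ?mul1r.
  have aT : 0 <= T - K <= T by lra.
  have := is_distr_transition (PT T T0) gen nud aT.
  (* Mixing for time [K] is applied to the law [q] reached at time [T - K]. *)
  move=> /mixK; set q := nu *m P T 0 (T - K) => mixq.
  have := transition_exp_mx (c := 4 * lam * (C1 * (K / T) ^+ m)) (PT T T0) gen Qfg nud aT.
  rewrite subKr -/q => close.
  have /close : forall s i, T - K <= s <= T ->
      \sum_j `|(interp_gen phis Qi Qf (s / T) - Qf) i j| <= 4 * lam * (C1 * (K / T) ^+ m).
    move=> s i /andP[sl sT].
    have s01 : 0 <= s / T <= 1.
      by rewrite divr_ge0 ?ler_pdivrMr ?mul1r//=; lra.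
    apply: interp_gen_dist => //; first by rewrite mulr_ge0 ?exprn_ge0 ?divr_ge0 ?ltW.
      exact: phis01.
    move=> k l kl; apply: (@le_trans _ _ (1 - phi (s / T))).
      by rewrite lerD2l lerN2 phile.
    apply: (le_trans (HC _ s01)); rewrite ler_pM2l//.
    have /andP[_ s1] := s01; rewrite lerXn2r ?nnegrE ?subr_ge0 ?divr_ge0 ?(ltW K0) ?(ltW T0)//.
    rewrite ler_pdivlMr// mulrBl divfK ?gt_eqF//; lra.
  move=> {}close; move: mixq; rewrite !tv_distE => mixq.
  have -> : nu *m P T 0 T - pif =
      (nu *m P T 0 T - q *m exp_mx (K *: Qf)) + (q *m exp_mx (K *: Qf) - pif).
    by rewrite addrA subrK.
  have := ler_l1_normD (nu *m P T 0 T - q *m exp_mx (K *: Qf)) (q *m exp_mx (K *: Qf) - pif).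
  (* Mixing and perturbation each contribute [eps] in l1 norm, hence [eps] altogether in total
     variation. *)
  suff : 4 * lam * (C1 * (K / T) ^+ m) * K <= eps by lra.
  rewrite expr_div_n Tm.
  have -> : 4 * lam * (C1 * (K ^+ m / (C2 ^+ m * (lam / eps) * K ^+ m.+1))) * K =
      4 * C1 / C2 ^+ m * eps.
    by rewrite exprS; field; rewrite !gt_eqF ?exprn_gt0//.
  rewrite ler_piMl ?(ltW e0)// ler_pdivrMr ?exprn_gt0// mul1r.
  by rewrite (le_trans _ C2m)// /C2; lra.
rewrite poweR_EFin -!EFinM lee_fin /T.
rewrite [leRHS](_ : _ = C2 * (lam / eps) `^ m%:R^-1 * (2 `^ p * r `^ p)); last by ring.
rewrite -powRM ?(ltW r0)// ler_pM2l ?mulr_gt0//.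
by apply: ge0_ler_powR; rewrite ?nnegrE ?ltW// mulr_gt0.
Qed.
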